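(* Let $\mathcal{g} = T_0^{l_0} + T_1^{l_1} + T_2^{l_2}$ be a trinomial and $R(\mathcal{g}) = \mathbb{K}[T_{ij}]/(\mathcal{g})$ the corresponding trinomial algebra, equipped with the $K$-grading $\deg$. Suppose that there is at most one monomial in $\mathcal{g}$ including a variable with exponent $1$, that is, $l_{i_1j_1} = l_{i_2j_2} = 1$ implies $i_1 = i_2$. Then every nonzero $\deg$-homogeneous locally nilpotent derivation of the algebra $R(\mathcal{g})$ is elementary of Type II.
   Context: $\mathbb{K}$ is an algebraically closed field of characteristic zero. A derivation of a $\mathbb{K}$-algebra $R$ is a $\mathbb{K}$-linear map $\delta\colon R\to R$ with $\delta(fg)=\delta(f)g+f\delta(g)$; it is locally nilpotent if for every $f\in R$ there is a positive integer $m$ with $\delta^m(f)=0$. Trinomial algebras. Fix positive integers $n_0,n_1,n_2$, let $n=n_0+n_1+n_2$, and for each $i=0,1,2$ fix a tuple $l_i=(l_{i1},\ldots,l_{in_i})$ of positive integers. In the polynomial algebra $\mathbb{K}[T_{ij}]$ in the $n$ variables $T_{ij}$, $i=0,1,2$, $j=1,\ldots,n_i$, put $T_i^{l_i}=T_{i1}^{l_{i1}}\cdots T_{in_i}^{l_{in_i}}$. A trinomial is a polynomial $\mathcal{g}=T_0^{l_0}+T_1^{l_1}+T_2^{l_2}$ of this form; it is irreducible, and the domain $R(\mathcal{g})=\mathbb{K}[T_{ij}]/(\mathcal{g})$ is called a trinomial algebra. The same notation is used for elements of $\mathbb{K}[T_{ij}]$ and their images in $R(\mathcal{g})$. The grading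 $\deg$. Let $L=\begin{pmatrix}-l_0&l_1&0\\-l_0&0&l_2\end{pmatrix}$ (a $2\times n$ integer matrix), $L^*$ its transpose, $K=\mathbb{Z}^n/\operatorname{Im}L^*$, and $Q\colon\mathbb{Z}^n\to K$ the projection. With $e_{ij}$ the canonical basis vectors of $\mathbb{Z}^n$, setting $\deg T_{ij}=Q(e_{ij})$ defines a $K$-grading on $\mathbb{K}[T_{ij}]$ for which $\mathcal{g}$ is homogeneous, hence a $K$-grading on $R(\mathcal{g})$, denoted $\deg$. A derivation of a graded algebra $R=\bigoplus_{w\in K}R_w$ is homogeneous if it maps homogeneous elements to homogeneous elements (in which case there is $d\in K$ with $\delta(R_w)\subseteq R_{w+d}$ for all $w\in K$). The derivations $\delta_{C,\beta}$. Let $C=(c_0,c_1,c_2)$ with integers $1\le c_i\le n_i$, and let $0\ne\beta=(\beta_0,\beta_1,\beta_2)\in\mathbb{K}^3$ with $\beta_0+\beta_1+\beta_2=0$. Then either all $\beta_i\neq0$ or exactly one $\beta_{i_0}$ is zero. (i) If $\beta_i\ne0$ for all $i$ and there is at most one $i_1$ with $l_{i_1c_{i_1}}>1$, set $\delta_{C,\beta}(T_{ij})=\beta_i\prod_{k\ne i}\frac{\partial T_k^{l_k}}{\partial T_{kc_k}}$ if $j=c_i$, and $\delta_{C,\beta}(T_{ij})=0$ if $j\ne c_i$. (ii) If $\beta_{i_0}=0$ for a unique $i_0$ and there is at most one $i_1\neq i_0$ with $l_{i_1c_{i_1}}>1$, set $\delta_{C,\beta}(T_{ij})=\beta_i\prod_{k\ne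 i,i_0}\frac{\partial T_k^{l_k}}{\partial T_{kc_k}}$ if $j=c_i$, and $\delta_{C,\beta}(T_{ij})=0$ if $j\ne c_i$. By the Leibniz rule these define derivations of $\mathbb{K}[T_{ij}]$ killing $\mathcal{g}$, hence derivations $\delta_{C,\beta}$ of $R(\mathcal{g})$. ($\delta_{C,\beta}$ is defined only when the conditions of (i) or (ii) hold.) A derivation of $R(\mathcal{g})$ is elementary if it has the form $h\delta_{C,\beta}$ with $h\in R(\mathcal{g})$ a $\deg$-homogeneous element of the kernel of $\delta_{C,\beta}$. It is elementary of Type I (resp. Type II) if $\delta_{C,\beta}$ comes from case (i) (resp. case (ii)). *)

(* Defs.v *)
From HB Require Import structures.
From mathcomp Require Import all_boot all_order all_algebra.
From mathcomp Require Import boolp.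
From mathcomp Require Import mpoly.

Set Implicit Arguments.
Unset Strict Implicit.
Unset Printing Implicit Defensive.

Import GRing.Theory.
Local Open Scope ring_scope.
Local Open Scope quotient_scope.

Record trinomial := Trinomial {
  nvar : 'I_3 -> nat;
  texp : forall i, 'I_(nvar i) -> nat;
  nvar_gt0 : forall i, (0 < nvar i)%N;
  texp_gt0 : forall i (j : 'I_(nvar i)), (0 < texp j)%N }.

(* The index (i, j) of the variable T_ij is the pair Tagged _ j, listed by    *)
(* enum_rank so that mpoly's variables 'X_k, k < n, can be used.              *)
Definition tidx (g : trinomial) := {i : 'I_3 & 'I_(nvar g i)}.

Definition tnum (g : trinomial) : nat := #|{: tidx g}|.

Definition tvar (g : trinomial) i (j : 'I_(nvar g i)) : 'I_(tnum g) :=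
  enum_rank (Tagged (fun i => 'I_(nvar g i)) j).

Section TrinomialAlgebra.
Variables (KK : fieldType) (g : trinomial).

Definition tmon (i : 'I_3) : {mpoly KK[tnum g]} :=
  \prod_(j < nvar g i) 'X_(tvar j) ^+ texp j.

Definition tpoly : {mpoly KK[tnum g]} := \sum_(i < 3) tmon i.

Definition tideal : {pred {mpoly KK[tnum g]}} :=
  fun p => `[< exists q, p = q * tpoly >].

Lemma meval0_tpoly : meval (fun _ => 0 : KK) tpoly = 0.
Proof.
rewrite raddf_sum /= big1 // => i _; rewrite rmorph_prod /=.
rewrite (bigD1 (Ordinal (nvar_gt0 g i))) //= rmorphXn /= mevalXU.
by rewrite expr0n gtn_eqF ?texp_gt0 // mul0r.
Qed.

Lemma tideal_closed : idealr_closed tideal.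
Proof.
split; first by apply/asboolP; exists 0; rewrite mul0r.
  apply/asboolP => -[q] /(congr1 (meval (fun _ => 0 : KK))).
  by rewrite mevalM meval0_tpoly mulr0 meval1 => /eqP; rewrite oner_eq0.
move=> a u v /asboolP[p ->] /asboolP[q ->]; apply/asboolP.
by exists (a * p + q); rewrite mulrDl mulrA.
Qed.

HB.instance Definition _ := isIdealr.Build _ tideal tideal_closed.

Definition talg := {ideal_quot tideal}.

HB.instance Definition _ := GRing.ComNzRing.on talg.

Definition tpi : {mpoly KK[tnum g]} -> talg := \pi_talg.

Fact tpi_zmod_morphism : zmod_morphism tpi.
Proof. exact: pi_is_zmod_morphism. Qed.
Fact tpi_monoid_morphism : monoid_morphism tpi.
Proof. exact: pi_is_monoid_morphism. Qed.
HB.instance Definition _ := GRing.isZmodMorphism.Build _ _ tpi tpi_zmod_morphism.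
HB.instance Definition _ :=
  GRing.isMonoidMorphism.Build _ _ tpi tpi_monoid_morphism.

Definition talg_scale (c : KK) (x : talg) : talg := tpi c%:MP * x.

Fact talg_scaleA a b x :
  talg_scale a (talg_scale b x) = talg_scale (a * b) x.
Proof. by rewrite /talg_scale mulrA -rmorphM /= mpolyCM. Qed.
Fact talg_scale1 : left_id 1 talg_scale.
Proof. by move=> x; rewrite /talg_scale rmorph1 mul1r. Qed.
Fact talg_scaleDr : right_distributive talg_scale +%R.
Proof. by move=> a x y; rewrite /talg_scale mulrDr. Qed.
Fact talg_scaleDl x : {morph talg_scale^~ x : a b / a + b}.
Proof. by move=> a b; rewrite /talg_scale mpolyCD rmorphD mulrDl. Qed.
HB.instance Definition _ := GRing.Zmodule_isLmodule.Build KK talg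
  talg_scaleA talg_scale1 talg_scaleDr talg_scaleDl.

Fact talg_scaleAl (a : KK) (x y : talg) : a *: (x * y) = a *: x * y.
Proof. exact: mulrA. Qed.
HB.instance Definition _ := GRing.Lmodule_isLalgebra.Build KK talg talg_scaleAl.
HB.instance Definition _ := GRing.Lalgebra_isComAlgebra.Build KK talg.

Fact tpi_scalable : scalable tpi.
Proof. by move=> c p; rewrite -mul_mpolyC rmorphM. Qed.
HB.instance Definition _ := GRing.isScalable.Build KK _ _ _ tpi tpi_scalable.

Lemma tpi_eq0 p : (tpi p == 0) = (p \in tideal).
Proof. by rewrite -(rmorph0 tpi) -Quotient.idealrBE subr0. Qed.

Lemma tpi_surj (x : talg) : exists p, x = tpi p.
Proof. by exists (repr x); rewrite /tpi reprK. Qed.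

End TrinomialAlgebra.

Section Degree.
Variable g : trinomial.

(* Rows 0 and 1 are (-l_0, l_1, 0) and (-l_0, 0, l_2). *)
Definition Lmx : 'M[int]_(2, tnum g) :=
  \matrix_(r, k) let v : tidx g := enum_val k in
    if tag v == 0%N :> nat then - (texp (tagged v))%:Z
    else if tag v == r.+1 :> nat then (texp (tagged v))%:Z else 0.

Definition imLT : {pred 'cV[int]_(tnum g)} :=
  fun v => `[< exists z : 'cV[int]_2, v = Lmx^T *m z >].

Fact imLT_closed : zmod_closed imLT.
Proof.
split; first by apply/asboolP; exists 0; rewrite mulmx0.
move=> u v /asboolP[x ->] /asboolP[y ->]; apply/asboolP.
by exists (x - y); rewrite mulmxBr.
Qed.
HB.instance Definition _ := GRing.isZmodClosed.Build _ imLT imLT_closed.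

Definition degGroup := Quotient.quot imLT.
HB.instance Definition _ := GRing.Zmodule.on degGroup.

Definition degQ : 'cV[int]_(tnum g) -> degGroup := \pi_degGroup.

Definition mnm_degK (m : 'X_{1..tnum g}) : degGroup :=
  \sum_(k < tnum g) degQ (delta_mx k 0) *+ m k.

End Degree.

Section Derivations.
Variables (KK : fieldType) (g : trinomial).
Local Notation R := (talg KK g).

(* Membership in the component R_w, the image of the span of the monomials    *)
(* of degree w.                                                               *)
Definition in_comp (w : degGroup g) (x : R) : Prop :=
  exists2 p : {mpoly KK[tnum g]},
    (forall m, m \in msupp p -> mnm_degK m = w) & x = tpi p.

Definition homogeneous (x : R) : Prop := exists w, in_comp w x.

Definition homogeneous_map (d : R -> R) : Prop :=
  forall x, homogeneous x -> homogeneous (d x).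

Definition leibniz (d : R -> R) : Prop :=
  forall x y, d (x * y) = d x * y + x * d y.

Definition locally_nilpotent (d : R -> R) : Prop :=
  forall x, exists2 m, (0 < m)%N & iter m d x = 0.

Section Delta.
Variables (C : forall i : 'I_3, 'I_(nvar g i)) (beta : 'I_3 -> KK).

(* When all beta_i are nonzero the product is over all k != i; when exactly   *)
(* beta_(i0) vanishes it is over k != i, i0 (and the value for i = i0 is 0).  *)
Definition delta_val (i : 'I_3) : {mpoly KK[tnum g]} :=
  beta i *: \prod_(k < 3 | (k != i) && (beta k != 0)) (tmon KK g k)^`M(tvar (C k)).

Definition delta_poly (p : {mpoly KK[tnum g]}) : {mpoly KK[tnum g]} :=
  \sum_(i < 3) delta_val i * p^`M(tvar (C i)).

Definition delta (x : R) : R := tpi (delta_poly (repr x)).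

Definition caseI : Prop :=
  [/\ \sum_i beta i = 0, (forall i, beta i != 0) &
      forall i1 i2, (1 < texp (C i1))%N -> (1 < texp (C i2))%N -> i1 = i2].

Definition caseII : Prop :=
  \sum_i beta i = 0 /\
  exists i0, [/\ beta i0 = 0, (forall i, i != i0 -> beta i != 0) &
    forall i1 i2, i1 != i0 -> i2 != i0 ->
      (1 < texp (C i1))%N -> (1 < texp (C i2))%N -> i1 = i2].

Lemma delta_polyD p q : delta_poly (p + q) = delta_poly p + delta_poly q.
Proof.
by rewrite /delta_poly -big_split; apply: eq_bigr => i _; rewrite mderivD mulrDr.
Qed.

Lemma delta_polyM p q :
  delta_poly (p * q) = delta_poly p * q + p * delta_poly q.
Proof.
rewrite /delta_poly mulr_suml mulr_sumr -big_split; apply: eq_bigr => i _.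
by rewrite mderivM mulrDr !mulrA [delta_val i * p]mulrC.
Qed.

Lemma mderiv_prod_notin (I : finType) (F : I -> {mpoly KK[tnum g]}) v
    (P : pred I) : (forall i, P i -> (F i)^`M(v) = 0) ->
  (\prod_(i | P i) F i)^`M(v) = 0.
Proof.
move=> F0; apply: (big_ind (fun p : {mpoly KK[tnum g]} => p^`M(v) = 0)) => //.
  by rewrite -mpolyC1 mderivC.
by move=> p q p0 q0; rewrite mderivM p0 q0 mul0r mulr0 addr0.
Qed.

Lemma mderivXU (u v : 'I_(tnum g)) :
  ('X_u : {mpoly KK[tnum g]})^`M(v) = (u == v)%:R.
Proof.
rewrite mderivX mnm1E; case: eqP => [->|_]; last by rewrite scale0r.
rewrite scale1r; suff -> : (U_(v) - U_(v))%MM = 0%MM by rewrite mpolyX0.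
by apply/mnmP => i; rewrite mnmBE subnn mnm0E.
Qed.

Lemma mderiv_tmon_neq i k : k != i -> (tmon KK g k)^`M(tvar (C i)) = 0.
Proof.
move=> ki; apply: mderiv_prod_notin => j _.
rewrite -(card_ord (texp j)) -prodr_const; apply: mderiv_prod_notin => _ _.
rewrite mderivXU; case: eqP => // /enum_rank_inj /(congr1 tag) /= e.
by rewrite e eqxx in ki.
Qed.

Lemma delta_poly_tpoly : \sum_i beta i = 0 -> delta_poly (tpoly KK g) = 0.
Proof.
move=> sb0; rewrite /delta_poly.
pose P := \prod_(k < 3 | beta k != 0) (tmon KK g k)^`M(tvar (C k)).
suff -> : \sum_(i < 3) delta_val i * (tpoly KK g)^`M(tvar (C i))
        = \sum_(i < 3) beta i *: P by rewrite -scaler_suml sb0 scale0r.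
apply: eq_bigr => i _; rewrite /delta_val -scalerAl.
have [->|bi] := eqVneq (beta i) 0; first by rewrite !scale0r.
rewrite raddf_sum /= [X in _ * X](bigD1 i) //= [X in _ + X]big1 => [|k]; last first.
  exact: mderiv_tmon_neq.
rewrite addr0 mulrC /P [in RHS](bigD1 i) //=; congr (_ *: (_ * _)).
by apply: eq_bigl => k; rewrite andbC.
Qed.

Lemma delta_tpi p : \sum_i beta i = 0 -> delta (tpi p) = tpi (delta_poly p).
Proof.
move=> sb0; pose r := repr (tpi p).
have /asboolP[q rE] : r - p \in @tideal KK g.
  by rewrite Quotient.idealrBE; apply/eqP; rewrite reprK.
rewrite /delta -/r -[r](subrK p) rE delta_polyD rmorphD /=.
rewrite delta_polyM delta_poly_tpoly // mulr0 addr0.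
suff -> : tpi (delta_poly q * tpoly KK g) = 0 by rewrite add0r.
by apply/eqP; rewrite tpi_eq0; apply/asboolP; exists (delta_poly q).
Qed.

Lemma delta_tvar i (j : 'I_(nvar g i)) : \sum_i beta i = 0 ->
  delta (tpi 'X_(tvar j)) = if j == C i then tpi (delta_val i) else 0.
Proof.
move=> sb0; rewrite delta_tpi // /delta_poly (bigD1 i) //= big1 => [|k ki].
  rewrite addr0 mderivXU (inj_eq enum_rank_inj) eq_Tagged /=.
  by case: eqP => _; rewrite ?mulr1 ?mulr0 ?rmorph0.
rewrite mderivXU; case: eqP => [/enum_rank_inj /(congr1 tag) /= e|]; last first.
  by rewrite mulr0.
by rewrite e eqxx in ki.
Qed.

End Delta.

Definition elementary_of
    (cond : (forall i, 'I_(nvar g i)) -> ('I_3 -> KK) -> Prop) (d : R -> R) :=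
  exists C beta h, [/\ cond C beta, homogeneous h, delta C beta h = 0 &
    forall x, d x = h * delta C beta x].

Definition elementaryI := elementary_of caseI.
Definition elementaryII := elementary_of caseII.

End Derivations.

(* Main.v *)
Require Import Defs.
From HB Require Import structures.
From mathcomp Require Import all_boot all_order all_algebra.
From mathcomp Require Import boolp zify.
From mathcomp Require Import mpoly.

Set Implicit Arguments.
Unset Strict Implicit.
Unset Printing Implicit Defensive.

Import Order.TTheory GRing.Theory Num.Theory.
Local Open Scope ring_scope.

(** Write [x_i] for the monomial [T_i^(l_i)], so that [x_0 + x_1 + x_2 = 0] in
    the trinomial algebra [R], and let [d] be a nonzero homogeneous locally
    nilpotent derivation.

    The argument stays inside the set of homogeneous elements, which [d]
    preserves and in which products of nonzero elements are nonzero
    ([homog_mul_neq0]).  This already gives the two classical facts about a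
    locally nilpotent derivation, through the additivity of its degree: the
    kernel is factorially closed ([ker_factorially_closed]), and two elements
    cannot each divide the nonzero derivative of the other
    ([mutually_dividing_derivatives]).

    The homogeneous elements are explicit: all elements of one degree are
    [T^u F(x_a, x_b)] for one common monomial [T^u] and binary forms [F] of one
    common degree ([comp_binform]).  Divisibility by a variable [T_k] is tested
    at a point of the hypersurface where [T_k] is the only vanishing coordinate
    ([var_divides]), which makes [T_k] prime among homogeneous elements.  The
    shape of a component gives more: if some element of a component is not
    divisible by [T_k], with [T_k] in the block [i], then an element of that
    component that vanishes at the point is divisible by the whole [x_i]
    ([comp_vanishing]).

    Comparing elements of equal degree in this way, [d] moves at most one
    variable in each block, because [T_j d(T_j')] and [T_j' d(T_j)] have the
    same degree ([moved_variable_uniq]).  Likewise [d(x_a)] and [d(x_b)] have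
    the same degree, and if both moved variables occur with exponents greater
    than 1 then each divides the derivative of the other, which is impossible
    ([not_both_exponents_gt1]).  Two of the three blocks must be moved since
    the [d(x_i)] add up to zero.  If all three were, two of the three moved
    variables would have exponent 1, against the hypothesis; so exactly two are
    moved, which is Type II.

    It remains to read off the cofactor.  From [d(x_a) = - d(x_b)] and the
    coprimality of the monomials in different blocks, [d = h delta_(C, beta)]
    with [beta_a = 1] and [beta_b = -1] ([moved_factorization]).  Finally [h]
    divides [d(s)] for every [s]; taking [s] with [d(s)] a nonzero element of
    the kernel shows that [h] is in the kernel ([cofactor_in_ker]). *)

(** * Locally nilpotent derivations on multiplicative families of elements *)

Section LocallyNilpotent.

Variables (K : fieldType) (R : comAlgType K) (d : {linear R -> R}).
(* [H] stands for the set of homogeneous elements: integrality of [R] is replaced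
   by [mulH], which is much easier to establish for a graded ring. *)
Variable H : R -> Prop.

Hypothesis charK : [pchar K] =i pred0.
Hypothesis d_leibniz : forall x y, d (x * y) = d x * y + x * d y.
Hypothesis d_lnd : forall x, exists2 m, (0 < m)%N & iter m d x = 0.
Hypothesis dH : forall x, H x -> H (d x).
Hypothesis mulH : forall x y, H x -> H y -> x != 0 -> y != 0 -> x * y != 0.

(** The degree function attached to [d], as a relation since it is undefined at
    zero. *)
Definition lnd_deg m x := iter m d x != 0 /\ iter m.+1 d x = 0.

Lemma iter_linear0 m : iter m d 0 = 0.
Proof. by elim: m => //= m ->; rewrite linear0. Qed.

Lemma lnd_degP x : x != 0 -> exists m, lnd_deg m x.
Proof.
move=> x0; have [k _ kx] := d_lnd x.
have ex : exists k, iter k d x == 0 by exists k; rewrite kx.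
case: (ex_minnP ex) => -[|m] /eqP mx min; first by rewrite [x]mx eqxx in x0.
by exists m; split=> //; apply/negP => /min; rewrite ltnn.
Qed.

Lemma lnd_deg_uniq m k x : lnd_deg m x -> lnd_deg k x -> m = k.
Proof.
have lt_false a b : lnd_deg a x -> lnd_deg b x -> (a < b)%N -> False.
  move=> [_ a0] [/eqP b0 _] ab; case: b0.
  by rewrite -(subnK ab) iterD a0 iter_linear0.
move=> mx kx; case: (ltngtP m k) => // lt; first by case: (lt_false _ _ mx kx).
by case: (lt_false _ _ kx mx).
Qed.

Lemma lnd_deg_d m x : lnd_deg m (d x) -> lnd_deg m.+1 x.
Proof. by move=> [] /=; rewrite -!iterSr => ? ?; split. Qed.

Lemma iter_leibniz N x y :
  iter N d (x * y) = \sum_(i < N.+1) (iter i d x * iter (N - i) d y) *+ 'C(N, i).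
Proof.
elim: N => [|N IH]; first by rewrite big_ord1.
rewrite iterS IH linear_sum /=.
under eq_bigr => i _ do rewrite linearMn d_leibniz -!iterS mulrnDl.
rewrite big_split /= [RHS]big_ord_recl [X in _ + X]big_ord_recl /=.
rewrite subn0 bin0.
under [in RHS]eq_bigr => i _ do rewrite /bump /= add0n subSS binS addnC mulrnDr.
rewrite big_split /= addrCA; congr (_ + _).
congr (_ + _).
rewrite [RHS]big_ord_recr /= bin_small // mulr0n addr0.
apply: eq_bigr => i _; rewrite /bump /= add0n add1n.
by have -> : (N - i = (N - i.+1).+1)%N by rewrite -subSn // subSS.
Qed.

(** In the Leibniz formula for [d^(m+k) (x * y)] only the term
    ['C(m + k, m) d^m(x) d^k(y)] survives, and it is nonzero in characteristic
    zero; in the formula one order higher nothing survives. *)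
Lemma lnd_degM m k x y : H x -> H y -> lnd_deg m x -> lnd_deg k y ->
  lnd_deg (m + k) (x * y).
Proof.
have HI a z : H z -> H (iter a d z) by move=> Hz; elim: a => //= a; apply: dH.
have big0 a b z : lnd_deg a z -> (a < b)%N -> iter b d z = 0.
  by move=> [_ z0] ab; rewrite -(subnK ab) iterD z0 iter_linear0.
move=> Hx Hy mx ky; split; last first.
  rewrite iter_leibniz big1 // => i _; case: (ltnP m i) => mi.
    by rewrite (big0 _ _ _ mx mi) mul0r mul0rn.
  rewrite (big0 _ _ _ ky) ?mulr0 ?mul0rn //.
  by rewrite ltn_subRL ltnS leq_add2r.
rewrite iter_leibniz (bigD1 (Ordinal (leq_addr k m : (m < (m + k).+1)%N))) //=.
rewrite big1 => [|i im]; last first.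
  have {}im : (i != m :> nat) by [].
  case: (ltngtP m i) im => // mi _; first by rewrite (big0 _ _ _ mx mi) mul0r mul0rn.
  rewrite (big0 _ _ _ ky) ?mulr0 ?mul0rn //.
  by rewrite ltn_subRL ltn_add2r.
rewrite addr0 addKn -scaler_nat scaler_eq0 negb_or.
rewrite ((pcharf0P K).1 charK) -lt0n bin_gt0 leq_addr /=.
by apply: mulH; [apply: HI|apply: HI|exact: mx.1|exact: ky.1].
Qed.

(** Degrees add up to 0, so both are 0. *)
Lemma ker_factorially_closed x y : H x -> H y -> x != 0 -> y != 0 ->
  d (x * y) = 0 -> d x = 0.
Proof.
move=> Hx Hy x0 y0 dxy; have [m mx] := lnd_degP x0; have [k ky] := lnd_degP y0.
have xy : lnd_deg 0 (x * y) by split=> //=; apply: mulH.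
have /esym/eqP := lnd_deg_uniq xy (lnd_degM Hx Hy mx ky).
by rewrite addn_eq0 => /andP[/eqP m0 _]; case: mx; rewrite m0.
Qed.

Lemma lnd_deg_divides x y z m : H x -> H z -> d y = x * z -> d y != 0 ->
  lnd_deg m x -> exists2 k, lnd_deg k y & (m < k)%N.
Proof.
move=> Hx Hz dy dy0 mx; have z0 : z != 0.
  by apply: contraNneq dy0 => z0; rewrite dy z0 mulr0.
have [k kz] := lnd_degP z0; exists (m + k).+1; last by rewrite ltnS leq_addr.
by apply: lnd_deg_d; rewrite dy; apply: lnd_degM.
Qed.

(** Applying [d] lowers the degree by one and dividing cannot raise it, so each of
    [x] and [y] would have a smaller degree than the other. *)
Lemma mutually_dividing_derivatives x y z t : H x -> H y -> H z -> H t ->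
  d y = x * z -> d x = y * t -> d x = 0 \/ d y = 0.
Proof.
move=> Hx Hy Hz Ht dy dx.
case: (eqVneq (d x) 0) => [|dx0]; first by left.
case: (eqVneq (d y) 0) => [|dy0]; first by right.
have x0 : x != 0 by apply: contraNneq dy0 => x0; rewrite dy x0 mul0r.
have y0 : y != 0 by apply: contraNneq dx0 => y0; rewrite dx y0 mul0r.
have [m mx] := lnd_degP x0; have [k ky] := lnd_degP y0.
have [k' ky' mk] := lnd_deg_divides Hx Hz dy dy0 mx.
have [m' mx' km] := lnd_deg_divides Hy Ht dx dx0 ky.
rewrite -(lnd_deg_uniq ky ky') in mk; rewrite -(lnd_deg_uniq mx mx') in km.
by have := ltn_trans mk km; rewrite ltnn.
Qed.

Lemma not_self_dividing_derivative x z : H x -> H z -> d x = x * z -> d x = 0.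
Proof. by move=> Hx Hz dx; case: (mutually_dividing_derivatives Hx Hx Hz Hz dx dx). Qed.

(** The last but one nonzero iterate of [d] on [x]. *)
Lemma local_slice x : H x -> d x != 0 -> exists s, [/\ H s, d s != 0 & d (d s) = 0].
Proof.
move=> Hx dx0; have [m mx] := lnd_degP dx0; exists (iter m d x); split.
- by elim: m {mx} => //= m; apply: dH.
- by rewrite -iterS iterSr; case: mx.
- by rewrite -!iterS iterSr; case: mx.
Qed.

End LocallyNilpotent.

(** * Degrees of monomials *)

Section Degrees.

Variable g : trinomial.
Implicit Types m : 'X_{1..tnum g}.

(** The exponent of the monomial [T_i^(l_i)]. *)
Definition xmnm (i : 'I_3) : 'X_{1..tnum g} :=
  [multinom let v : tidx g := enum_val k in
     if tag v == i then texp (tagged v) else 0%N | k < tnum g].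

Lemma xmnm_tvar i i' (j : 'I_(nvar g i')) :
  xmnm i (tvar j) = if i' == i then texp j else 0%N.
Proof. by rewrite mnmE /tvar enum_rankK. Qed.

Lemma tvarP (P : 'I_(tnum g) -> Prop) :
  (forall i (j : 'I_(nvar g i)), P (tvar j)) -> forall k, P k.
Proof.
move=> Pj k; rewrite -[k]enum_valK; case: (enum_val k) => i j; exact: Pj.
Qed.

Lemma tvar_inj i : injective (@tvar g i).
Proof. by move=> j j' /enum_rank_inj /eqP; rewrite eq_Tagged => /eqP. Qed.

Lemma tvar_block i i' (j : 'I_(nvar g i)) (j' : 'I_(nvar g i')) :
  tvar j = tvar j' -> i = i'.
Proof. by move=> /enum_rank_inj /(congr1 tag). Qed.

Lemma mnm_degKD m m' : mnm_degK (m + m')%MM = mnm_degK m + mnm_degK m'.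
Proof.
by rewrite /mnm_degK -big_split; apply: eq_bigr => k _; rewrite mnmDE mulrnDr.
Qed.

Lemma degQ_is_zmod_morphism : zmod_morphism (@degQ g).
Proof. exact: pi_is_zmod_morphism. Qed.

HB.instance Definition _ :=
  GRing.isZmodMorphism.Build _ _ (@degQ g) degQ_is_zmod_morphism.

Lemma mnm_degKE m : mnm_degK m = degQ (\col_k (m k)%:Z).
Proof.
rewrite /mnm_degK; under eq_bigr => k _ do rewrite -raddfMn.
rewrite -raddf_sum /=; congr degQ; apply/colP => k; rewrite summxE mxE.
rewrite (bigD1 k) //= big1 ?addr0; last first.
  by move=> l lk; rewrite mulmxnE mxE eq_sym (negbTE lk) mul0rn.
by rewrite mulmxnE mxE !eqxx pmulrn mulrzz mul1r.
Qed.

Lemma Lmx_tvar i (j : 'I_(nvar g i)) (z : 'cV[int]_2) :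
  ((Lmx g)^T *m z) (tvar j) 0
  = [:: - (z 0 0 + z 1 0); z 0 0; z 1 0]`_i * (texp j)%:Z.
Proof.
rewrite !mxE big_ord_recl big_ord1 !mxE /= /tvar enum_rankK /=.
rewrite (_ : lift 0 0 = 1); last exact: val_inj.
move: (texp j) => e; case: i j => [[|[|[|//]]]] lt _ /=.
- by rewrite -mulrDr !mulNr mulrC.
- by rewrite mul0r addr0 mulrC.
- by rewrite mul0r add0r mulrC.
Qed.

(** The two rows of the matrix defining the degree span the combinations of the
    three exponent vectors [l_0], [l_1], [l_2] with coefficients of sum zero, and
    this symmetric description is the one used from here on. *)
Lemma mnm_degK_eqP m m' : mnm_degK m = mnm_degK m' <->
  exists2 a : 'I_3 -> int, \sum_i a i = 0 &
    forall i (j : 'I_(nvar g i)),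
      (m (tvar j))%:Z = (m' (tvar j))%:Z + a i * (texp j)%:Z.
Proof.
set u := \col_k (m k)%:Z; set v := \col_k (m' k)%:Z.
have eqE : mnm_degK m = mnm_degK m' <->
    exists z : 'cV[int]_2, u - v = (Lmx g)^T *m z.
  rewrite !mnm_degKE; split=> [/eqP|zP].
    by rewrite -Quotient.idealrBE => /asboolP.
  by apply/eqP; rewrite -Quotient.idealrBE; apply/asboolP.
rewrite eqE; split=> [[z zP]|[a a0 aP]].
  exists (fun i : 'I_3 => [:: - (z 0 0 + z 1 0); z 0 0; z 1 0]`_i).
    by rewrite !big_ord_recl big_ord0 /= addr0 addNr.
  move=> i j; have /colP/(_ (tvar j)) := zP; rewrite Lmx_tvar !mxE /= => <-.
  by rewrite [RHS]addrC subrK.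
exists (\col_r a (lift 0 r)); apply/colP; apply: tvarP => i j.
rewrite Lmx_tvar !mxE aP addrAC subrr add0r /=; congr (_ * _).
move: a0; rewrite big_ord_recl => /eqP; rewrite addr_eq0 => /eqP a0.
case: i j => [[|[|[|//]]]] lt _ /=.
- rewrite [LHS](_ : _ = a 0); last by congr a; apply: val_inj.
  by rewrite a0 big_ord_recl big_ord1; congr (- (a _ + a _)); apply: val_inj.
- by congr a; apply: val_inj.
- by congr a; apply: val_inj.
Qed.

Lemma mnm_degK_xmnm i i' : mnm_degK (xmnm i) = mnm_degK (xmnm i').
Proof.
apply/mnm_degK_eqP; exists (fun k => (k == i)%:Z - (k == i')%:Z).
  have sum1 (l : 'I_3) : \sum_k (k == l)%:Z = 1 :> int.
    by rewrite (bigD1 l) //= eqxx big1 ?addr0 // => k /negbTE ->.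
  by rewrite sumrB !sum1 subrr.
move=> k j; rewrite !xmnm_tvar mulrBl.
case: (k == i); case: (k == i'); rewrite ?mul1r ?mul0r ?subr0 ?addr0 //.
all: try by rewrite ?sub0r ?addrN ?addr0 ?add0r.
Qed.

End Degrees.

(** * Homogeneous components of polynomials *)

Section Grading.

Variables (KK : fieldType) (g : trinomial).
Local Notation R := (talg KK g).
Implicit Types (p q : {mpoly KK[tnum g]}) (w : degGroup g) (x y a : R).

Lemma tmonE i : tmon KK g i = 'X_[xmnm g i].
Proof.
rewrite /tmon mprodXnE; congr 'X_[_].
apply/mnmP; apply: tvarP => i' j'; rewrite xmnm_tvar mnm_sumE.
case: (eqVneq i' i) => [ii'|ii'].
  rewrite -{i}ii'; rewrite (bigD1 j') //= mulmnE mnm1E eqxx mul1n big1 ?addn0 //.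
  move=> j jj'; rewrite mulmnE mnm1E; case: eqP => // /tvar_inj e.
  by rewrite e eqxx in jj'.
rewrite big1 // => j _; rewrite mulmnE mnm1E; case: eqP => // /tvar_block e.
by rewrite e eqxx in ii'.
Qed.

Definition hpoly w p := forall m, m \in msupp p -> mnm_degK m = w.

Lemma hpolyD w p q : hpoly w p -> hpoly w q -> hpoly w (p + q).
Proof.
by move=> hp hq m /msuppD_le; rewrite mem_cat => /orP[/hp|/hq].
Qed.

Lemma hpolyM w w' p q : hpoly w p -> hpoly w' q -> hpoly (w + w') (p * q).
Proof.
move=> hp hq m /msuppM_le /allpairsP[[m1 m2] /= [m1p m2q ->]].
by rewrite mnm_degKD hp ?hq.
Qed.

Lemma hpolyZ w c p : hpoly w p -> hpoly w (c *: p).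
Proof. by move=> hp m /msuppZ_le /hp. Qed.

Lemma hpolyX m : hpoly (mnm_degK m) ('X_[m] : {mpoly KK[tnum g]}).
Proof. by move=> m'; rewrite msuppX inE => /eqP ->. Qed.

Lemma hpoly_tpoly : hpoly (mnm_degK (xmnm g 0)) (tpoly KK g).
Proof.
rewrite /tpoly; apply: (big_ind (hpoly (mnm_degK (xmnm g 0)))).
- by move=> m; rewrite msupp0.
- exact: hpolyD.
- by move=> i _; rewrite tmonE (mnm_degK_xmnm g 0 i); apply: hpolyX.
Qed.

(** Homogeneous part of degree [w]; it is compatible with the quotient because the
    trinomial is itself homogeneous. *)
Definition hpart w p : {mpoly KK[tnum g]} :=
  \sum_(m <- msupp p | mnm_degK m == w) p@_m *: 'X_[m].

Lemma mcoeff_hpart w p m :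
  (hpart w p)@_m = if mnm_degK m == w then p@_m else 0.
Proof.
rewrite /hpart -big_filter; set s := [seq i <- _ | _].
have us : uniq s by rewrite filter_uniq // msupp_uniq.
rewrite linear_sum /=; under eq_bigr => i _ do rewrite mcoeffZ mcoeffX.
case: (boolP (m \in s)) => [ms|ms].
  rewrite (bigD1_seq m) //= eqxx mulr1 big1 ?addr0 => [|i /negbTE ->]; last first.
    by rewrite mulr0.
  by move: ms; rewrite mem_filter => /andP[->].
rewrite big1_seq => [|i /= ims]; last first.
  by case: eqP => [im|_]; [rewrite -im ims in ms|rewrite mulr0].
move: ms; rewrite mem_filter; case: (_ == w) => //=.
by rewrite -mcoeff_eq0 => /eqP.
Qed.

Lemma hpoly_hpart w p : hpoly w (hpart w p).
Proof.
by move=> m; rewrite mcoeff_msupp mcoeff_hpart; case: (_ =P w) => // _; rewrite eqxx.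
Qed.

Lemma hpartD w p q : hpart w (p + q) = hpart w p + hpart w q.
Proof.
apply/mpolyP => m; rewrite mcoeffD !mcoeff_hpart mcoeffD.
by case: eqP; rewrite ?addr0.
Qed.

Lemma hpart_hpoly w w' p : hpoly w' p -> hpart w p = if w' == w then p else 0.
Proof.
move=> hp; apply/mpolyP => m; rewrite mcoeff_hpart.
case: (boolP (m \in msupp p)) => [/hp ->|]; first by case: eqP; rewrite ?mcoeff0.
by rewrite -mcoeff_eq0 => /eqP p0; case: eqP; case: eqP; rewrite ?mcoeff0.
Qed.

Lemma hpartM w w' p q : hpoly w' q -> hpart w (p * q) = hpart (w - w') p * q.
Proof.
move=> hq; elim/mpolyind: p => [|c m p _ _ IH].
  by rewrite mul0r (@hpart_hpoly _ w) ?(@hpart_hpoly _ w 0) //;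
    [rewrite !if_same mul0r|move=> m; rewrite msupp0..].
rewrite mulrDl !hpartD IH mulrDl; congr (_ + _).
have hm : hpoly (mnm_degK m) (c *: 'X_[m]) by apply/hpolyZ/hpolyX.
rewrite (hpart_hpoly _ hm) (hpart_hpoly _ (hpolyM hm hq)).
rewrite [mnm_degK m == _]eq_sym subr_eq [w == _]eq_sym.
by case: (_ == w); rewrite ?mul0r.
Qed.

Lemma sum_hpart p :
  p = \sum_(w <- undup [seq mnm_degK m | m <- msupp p]) hpart w p.
Proof.
apply/mpolyP => m; rewrite linear_sum /=.
under eq_bigr => w _ do rewrite mcoeff_hpart.
case: (boolP (m \in msupp p)) => [mp|]; last first.
  by rewrite -mcoeff_eq0 => /eqP ->; rewrite big1 // => w _; rewrite if_same.
rewrite (bigD1_seq (mnm_degK m)) ?undup_uniq ?mem_undup ?map_f //= eqxx.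
by rewrite big1 ?addr0 // => w /negbTE; rewrite eq_sym => ->.
Qed.

End Grading.

(** * The grading of the trinomial algebra *)

Section Comp.
Variables (KK : fieldType) (g : trinomial).
Local Notation R := (talg KK g).
Local Notation tX m := (tpi ('X_[m] : {mpoly KK[tnum g]}) : R).
Implicit Types (p q : {mpoly KK[tnum g]}) (w : degGroup g) (x y a : R).

Definition rcomp w x : R := tpi (hpart w (repr x)).

Lemma repr_tpi p : exists q, repr (tpi p) = p + q * tpoly KK g.
Proof.
have /asboolP[q qE] : repr (tpi p) - p \in @tideal KK g.
  by rewrite Quotient.idealrBE; apply/eqP; rewrite reprK.
by exists q; rewrite -qE addrC subrK.
Qed.

Lemma tpi_tpoly : tpi (tpoly KK g) = 0.
Proof.
by apply/eqP; rewrite tpi_eq0; apply/asboolP; exists 1; rewrite mul1r.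
Qed.

Lemma rcomp_tpi w p : rcomp w (tpi p) = tpi (hpart w p).
Proof.
have [q qE] := repr_tpi p.
by rewrite /rcomp qE hpartD (hpartM _ _ (@hpoly_tpoly KK g)) rmorphD rmorphM /=
     tpi_tpoly mulr0 addr0.
Qed.

Lemma rcompD w x y : rcomp w (x + y) = rcomp w x + rcomp w y.
Proof.
have [p ->] := tpi_surj x; have [q ->] := tpi_surj y.
by rewrite -rmorphD !rcomp_tpi hpartD rmorphD.
Qed.

Lemma in_comp_rcomp w x : in_comp w (rcomp w x).
Proof. by exists (hpart w (repr x)) => //; apply: hpoly_hpart. Qed.

Lemma rcomp_in_comp w w' x : in_comp w' x -> rcomp w x = if w' == w then x else 0.
Proof.
by move=> [p hp ->]; rewrite rcomp_tpi (hpart_hpoly _ hp); case: eqP; rewrite ?rmorph0.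
Qed.

Lemma rcompM w w' a y : in_comp w' a -> rcomp w (a * y) = a * rcomp (w - w') y.
Proof.
move=> [p hp ->]; have [q ->] := tpi_surj y.
by rewrite -rmorphM !rcomp_tpi mulrC (hpartM _ _ hp) rmorphM mulrC.
Qed.

Lemma rcomp_eq0 x : (forall w, rcomp w x = 0) -> x = 0.
Proof.
have [p ->] := tpi_surj x => p0; rewrite (sum_hpart p) rmorph_sum big1 // => w _.
by have := p0 w; rewrite rcomp_tpi.
Qed.

Lemma in_comp0 w : in_comp w (0 : R).
Proof. by exists 0; rewrite ?rmorph0 // => m; rewrite msupp0. Qed.

Lemma in_compM w w' x y : in_comp w x -> in_comp w' y -> in_comp (w + w') (x * y).
Proof.
move=> [p hp ->] [q hq ->]; exists (p * q); last by rewrite rmorphM.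
exact: hpolyM.
Qed.

Lemma in_compZ w c x : in_comp w x -> in_comp w (c *: x).
Proof.
move=> [p hp ->]; exists (c *: p); last by rewrite linearZ.
exact: hpolyZ.
Qed.

Lemma in_compX m : in_comp (mnm_degK m) (tX m).
Proof. by exists 'X_[m] => //; apply: hpolyX. Qed.

Lemma homogZ c x : homogeneous x -> homogeneous (c *: x).
Proof. by move=> [w hx]; exists w; apply: in_compZ. Qed.

Lemma homogX m : homogeneous (tX m).
Proof. by exists (mnm_degK m); apply: in_compX. Qed.

(** Only the component of [y] in the right degree contributes to [a * y]. *)
Lemma homog_quot a y : homogeneous a -> homogeneous (a * y) ->
  exists2 z, homogeneous z & a * y = a * z.
Proof.
move=> [w ha] [w' hay]; exists (rcomp (w' - w) y).
  by exists (w' - w); apply: in_comp_rcomp.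
by rewrite -(rcompM _ _ ha) (rcomp_in_comp _ hay) eqxx.
Qed.

Lemma homog_add_same_degree w w' x y : in_comp w x -> in_comp w' y ->
  x != 0 -> y != 0 -> homogeneous (x + y) -> w = w'.
Proof.
move=> hx hy x0 y0 [v hv]; apply/eqP; apply: contraT => ww'.
have := rcomp_in_comp w hv; have := rcomp_in_comp w' hv.
rewrite !rcompD !(rcomp_in_comp _ hx) !(rcomp_in_comp _ hy) !eqxx.
rewrite [w' == w]eq_sym (negbTE ww') addr0 add0r.
case: eqP => [->|_ y00]; last by rewrite y00 eqxx in y0.
by rewrite eq_sym (negbTE ww') => _ x00; rewrite x00 eqxx in x0.
Qed.

End Comp.

(** * Binary forms *)

Section BinaryForms.
Variables (K : comNzRingType) (A : comAlgType K).
Implicit Types (P Q : {poly K}) (y z : A).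

(** The homogenization in degree [N] of the one-variable polynomial [P].  Keeping
    [P] lets a nonzero form be recognized by its values at [(1, s)]. *)
Definition binform N P y z : A := \sum_(j < N.+1) P`_j *: (y ^+ (N - j) * z ^+ j).

Lemma binformD N P Q y z : binform N (P + Q) y z = binform N P y z + binform N Q y z.
Proof.
by rewrite /binform -big_split; apply: eq_bigr => j _; rewrite coefD scalerDl.
Qed.

Lemma binformZ N c P y z : binform N (c *: P) y z = c *: binform N P y z.
Proof.
by rewrite /binform scaler_sumr; apply: eq_bigr => j _; rewrite coefZ scalerA.
Qed.

Lemma binformMl N P y z : (size P <= N.+1)%N ->
  binform N.+1 P y z = y * binform N P y z.
Proof.
move=> sP; rewrite /binform big_ord_recr /= nth_default // scale0r addr0 mulr_sumr.
apply: eq_bigr => j _; rewrite -scalerAr mulrA -exprS subSn //.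
by rewrite -ltnS.
Qed.

Lemma binformMr N P y z : binform N.+1 ('X * P) y z = z * binform N P y z.
Proof.
rewrite /binform big_ord_recl coefXM eqxx scale0r add0r mulr_sumr.
apply: eq_bigr => j _; rewrite coefXM /= -scalerAr mulrCA -exprS.
by congr (_ *: (_ ^+ _ * _)).
Qed.

Lemma size_linear_power b c :
  (size ((- 1 - 'X) ^+ c * 'X^b : {poly K})%R <= (b + c).+1)%N.
Proof.
apply: leq_trans (size_polyMleq _ _) _; rewrite size_polyXn addnS /=.
rewrite addnC -addnS leq_add2l; apply: leq_trans (size_poly_exp_leq _ _) _.
rewrite ltnS -[leqRHS]mul1n leq_mul2r; apply/orP; right.
rewrite /= -subn1 leq_subLR.
apply: leq_trans (size_polyD _ _) _; rewrite !size_polyN size_polyX.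
by rewrite geq_max size_poly1.
Qed.

(** The image of a monomial [x_a^a x_b^b x_c^c] after elimination of the third
    block by [x_c = - x_a - x_b]. *)
Lemma binform_mon a b c y z :
  binform (a + (b + c)) ((- 1 - 'X) ^+ c * 'X^b) y z
  = y ^+ a * (z ^+ b * (- y - z) ^+ c).
Proof.
have sX c' := size_linear_power b c'.
elim: a => [|a IH]; last first.
  by rewrite addSn binformMl ?IH ?exprS ?mulrA // (leq_trans (sX c)) // ltnS leq_addl.
rewrite add0n expr0 mul1r; elim: c => [|c IH].
  rewrite addn0 expr0 mul1r mulr1; elim: b {sX} => [|b IH].
    by rewrite /binform big_ord1 /= expr0 coef1 scale1r mulr1.
  by rewrite exprS binformMr IH exprS.
rewrite addnS [in LHS]exprS -mulrA mulrBl mulN1r.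
set P := _ * 'X^b in IH *; rewrite -[- P]scaleN1r.
rewrite -[- ('X * P)]scaleN1r binformD !binformZ binformMr binformMl //; last exact: sX.
by rewrite IH !scaleN1r -!mulNr -mulrDl [in RHS]exprS mulrCA.
Qed.

End BinaryForms.

(** * Normal form of a homogeneous component *)

Section MonomialNormalForm.
Variable g : trinomial.

(** Starting from one exponent of the given degree, removing each [l_i] as often as
    possible yields an exponent [u] that every other exponent of that degree
    dominates, because two of them differ by a combination of the [l_i]. *)
Lemma mnm_degK_normal (m0 : 'X_{1..tnum g}) :
  exists (u : 'X_{1..tnum g}) (N : nat), forall m, mnm_degK m = mnm_degK m0 ->
    exists2 e : 'I_3 -> nat, (\sum_i e i)%N = N &
      m = (u + \sum_i xmnm g i *+ e i)%MM.
Proof.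
(* [q i] is the largest power of [x_i] that divides [T^m0]. *)
pose P i q := [forall j : 'I_(nvar g i), q * texp j <= m0 (tvar j)]%N.
have exP i : exists q, P i q by exists 0%N; apply/forallP => j; rewrite mul0n.
have bndP i q : P i q -> (q <= m0 (tvar (Ordinal (nvar_gt0 g i))))%N.
  move=> /forallP /(_ (Ordinal (nvar_gt0 g i))) /(leq_trans _); apply.
  by rewrite leq_pmulr // texp_gt0.
pose q i := ex_maxn (exP i) (@bndP i).
have qP i (j : 'I_(nvar g i)) : (q i * texp j <= m0 (tvar j))%N.
  by rewrite /q; case: ex_maxnP => ? /forallP.
have q_max i q' : P i q' -> (q' <= q i)%N by rewrite /q; case: ex_maxnP => ? _; apply.
exists [multinom let v : tidx g := enum_val k in
          (m0 k - q (tag v) * texp (tagged v))%N | k < tnum g], (\sum_i q i)%N.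
move=> m /mnm_degK_eqP[a a0 aP].
have aq i : 0 <= a i + (q i)%:Z.
  have [ai|ai] := leP 0 (a i); first by rewrite addr_ge0.
  have nE : (`|- a i|%N)%:Z = - a i by rewrite gez0_abs // oppr_ge0 ltW.
  rewrite -lerBlDl sub0r -nE lez_nat.
  apply: q_max; apply/forallP => j; rewrite -lez_nat PoszM.
  by rewrite nE mulNr -subr_ge0 opprK -aP.
have eE i : (absz (a i + (q i)%:Z))%:Z = a i + (q i)%:Z by rewrite gez0_abs.
exists (fun i => absz (a i + (q i)%:Z)).
  apply/eqP; rewrite -eqz_nat !(big_morph Posz PoszD (erefl _)).
  by rewrite (eq_bigr _ (fun i _ => eE i)) big_split /= a0 add0r.
apply/mnmP; apply: tvarP => i j; rewrite mnmDE mnm_sumE mnmE /tvar enum_rankK /=.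
rewrite -/(tvar j) (bigD1 i) //= big1 => [|i' ii']; last first.
  by rewrite mulmnE xmnm_tvar eq_sym (negbTE ii') mul0n.
apply/eqP; rewrite -eqz_nat addn0 mulmnE xmnm_tvar eqxx PoszD -subzn ?qP // !PoszM.
by rewrite eE aP mulrDr addrACA [_ * (q i)%:Z]mulrC [_%:Z * a i]mulrC addNr addr0.
Qed.

End MonomialNormalForm.

Lemma third_index (a b : 'I_3) : a != b -> exists c, [/\ c != a, c != b &
  forall i, [\/ i = a, i = b | i = c]].
Proof.
move=> ab; have {}ab : (a != b :> nat) by [].
have lt3 (i : 'I_3) : (i < 3)%N by [].
have := lt3 a; have := lt3 b => lb la.
have cE : (inord (3 - a - b) : 'I_3) = (3 - a - b)%N :> nat by rewrite inordK //; lia.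
exists (inord (3 - a - b)); split; rewrite -?val_eqE /= ?cE; [lia|lia|] => i.
have [ia|ia] := eqVneq (val i) a; first by apply: Or31; apply: val_inj.
have [ib|ib] := eqVneq (val i) b; first by apply: Or32; apply: val_inj.
by apply: Or33; apply: val_inj; rewrite /= cE; have := lt3 i; move: ia ib => /=; lia.
Qed.

Lemma big_ord3 (T : Type) (idx : T) (op : Monoid.com_law idx) (a b c : 'I_3)
    (F : 'I_3 -> T) :
    a != b -> c != a -> c != b -> (forall i, [\/ i = a, i = b | i = c]) ->
  \big[op/idx]_i F i = op (F a) (op (F b) (F c)).
Proof.
move=> ab ca cb all3; rewrite (bigD1 a) // (bigD1 b) 1?eq_sym //.
rewrite (bigD1 c) ?ca //= big1 ?Monoid.mulm1 // => i /andP[/andP[ia ib] ic].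
by case: (all3 i) => e; rewrite e eqxx in ia ib ic.
Qed.

Section NormalForm.
Variables (KK : fieldType) (g : trinomial).
Local Notation R := (talg KK g).
Local Notation tX m := (tpi ('X_[m] : {mpoly KK[tnum g]}) : R).
Local Notation tx i := (tX (xmnm g i)).

Lemma tpi_tpoly_sum : \sum_i tx i = 0.
Proof.
rewrite -[RHS](tpi_tpoly KK g) rmorph_sum; apply: eq_bigr => i _.
by rewrite tmonE.
Qed.

Lemma tXD m m' : tX (m + m')%MM = tX m * tX m'.
Proof. by rewrite mpolyXD rmorphM. Qed.

Lemma tXMn m n : tX (m *+ n)%MM = tX m ^+ n.
Proof. by rewrite -mpolyXn rmorphXn. Qed.

(** Every monomial of degree [w] is [T^u] times a monomial of fixed degree [N] in
    the [x_i]; the relation [x_0 + x_1 + x_2 = 0] removes one of them.  That [u]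
    and [N] depend on [w] only is what allows elements of the same degree to be
    compared. *)
Lemma comp_binform (a b : 'I_3) (w : degGroup g) : a != b ->
  exists (u : 'X_{1..tnum g}) (N : nat), forall x : R, in_comp w x ->
    exists P : {poly KK}, (size P <= N.+1)%N /\
      x = tX u * binform N P (tx a) (tx b).
Proof.
move=> ab; have [c [ca cb all3]] := third_index ab.
have tc : tx c = - tx a - tx b.
  have := tpi_tpoly_sum; rewrite (big_ord3 _ _ ab ca cb all3) /= => /eqP.
  by rewrite addrA addrC addr_eq0 opprD => /eqP.
have [[m0 m0w]|no_m] := EM (exists m, mnm_degK m = w); last first.
  exists 0%MM, 0%N => x [p hp ->]; exists 0; rewrite size_poly0; split=> //.
  have -> : p = 0.
    apply/mpolyP => m; rewrite mcoeff0; apply/eqP; rewrite mcoeff_eq0.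
    by apply/negP => mp; case: no_m; exists m; apply: hp.
  by rewrite rmorph0 /binform big_ord1 coef0 scale0r mulr0.
have [u [N uN]] := mnm_degK_normal m0; exists u, N => x [p hp ->].
rewrite [p]mpolyE; move: hp; rewrite /=.
elim: (msupp p) => [|m s IH] hp.
  exists 0; rewrite size_poly0; split=> //.
  rewrite big_nil rmorph0 /binform big1 ?mulr0 // => j _.
  by rewrite coef0 scale0r.
case: IH => [m' m's|P [sP PE]]; first by apply: hp; rewrite inE m's orbT.
have [|e eN mE] := uN m; first by rewrite hp ?mem_head.
pose Q : {poly KK} := (- 1 - 'X) ^+ e c * 'X^(e b).
exists (p@_m *: Q + P); split.
  apply: leq_trans (size_polyD _ _) _; rewrite geq_max sP andbT.
  apply: leq_trans (size_scale_leq _ _) _; apply: leq_trans (size_linear_power _ _ _) _.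
  by rewrite ltnS -eN (big_ord3 _ _ ab ca cb all3) /= leq_addl.
rewrite big_cons linearP /= PE binformD binformZ mulrDr -scalerAr.
congr (_ *: _ + _); rewrite {1}mE tXD; congr (_ * _).
rewrite -eN !(big_ord3 _ _ ab ca cb all3) /= binform_mon -tc !tXD !tXMn.
by [].
Qed.

End NormalForm.

(** * Points of the trinomial hypersurface *)

Section Points.
Variables (KK : closedFieldType) (g : trinomial).
Local Notation R := (talg KK g).
Local Notation tX m := (tpi ('X_[m] : {mpoly KK[tnum g]}) : R).
Local Notation tx i := (tX (xmnm g i)).

Record point := Point {
  coord :> 'I_(tnum g) -> KK;
  pointP : (tpoly KK g).@[coord] = 0 }.

Definition ev (t : point) (x : R) : KK := (repr x).@[t].

Lemma ev_tpi t p : ev t (tpi p) = p.@[t].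
Proof.
by have [q qE] := repr_tpi p; rewrite /ev qE mevalD mevalM pointP mulr0 addr0.
Qed.

Fact ev_zmod_morphism t : zmod_morphism (ev t).
Proof.
move=> x y; have [p ->] := tpi_surj x; have [q ->] := tpi_surj y.
by rewrite -rmorphB !ev_tpi mevalB.
Qed.

Fact ev_monoid_morphism t : monoid_morphism (ev t).
Proof.
split=> [|x y]; first by rewrite -(rmorph1 (@tpi KK g)) ev_tpi meval1.
have [p ->] := tpi_surj x; have [q ->] := tpi_surj y.
by rewrite -rmorphM !ev_tpi mevalM.
Qed.

HB.instance Definition _ t :=
  GRing.isZmodMorphism.Build R KK (ev t) (ev_zmod_morphism t).
HB.instance Definition _ t :=
  GRing.isMonoidMorphism.Build R KK (ev t) (ev_monoid_morphism t).

Lemma evZ t c x : ev t (c *: x) = c * ev t x.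
Proof. by have [p ->] := tpi_surj x; rewrite -linearZ !ev_tpi mevalZ. Qed.

Lemma ev_binform t N P y z : ev t (binform N P y z) =
  \sum_(j < N.+1) P`_j * (ev t y ^+ (N - j) * ev t z ^+ j).
Proof.
rewrite rmorph_sum; apply: eq_bigr => j _.
by rewrite /= evZ rmorphM !rmorphXn.
Qed.

Lemma ev_tX t m : ev t (tX m) = \prod_k t k ^+ m k.
Proof. by rewrite ev_tpi mevalX. Qed.

Lemma closed_root (l : nat) (c : KK) : (0 < l)%N -> exists r, r ^+ l = c.
Proof.
move=> l0; have [r rE] := solve_monicpoly (fun i => if i is 0%N then c else 0) l0.
exists r; rewrite rE; case: l l0 {rE} => // l _.
by rewrite big_ord_recl /= expr0 mulr1 big1 ?addr0 // => i _; rewrite mul0r.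
Qed.

(** One root per block suffices, the other coordinates being 1; in a block of value
    zero the chosen coordinate is then the only one that vanishes. *)
Lemma exists_point (X : 'I_3 -> KK) (C : forall i, 'I_(nvar g i)) :
  \sum_i X i = 0 ->
  exists t : point, (forall i, ev t (tx i) = X i) /\
    (forall i (j : 'I_(nvar g i)), (t (tvar j) == 0) = (j == C i) && (X i == 0)).
Proof.
move=> X0; have /fin_all_exists[r rE] : forall i, exists r, r ^+ texp (C i) = X i.
  by move=> i; apply: closed_root; apply: texp_gt0.
pose t (k : 'I_(tnum g)) := let v : tidx g := enum_val k in
  if tagged v == C (tag v) then r (tag v) else 1.
have tE i (j : 'I_(nvar g i)) : t (tvar j) = if j == C i then r i else 1.
  by rewrite /t /tvar enum_rankK.
have tmonX i : (tmon KK g i).@[t] = X i.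
  rewrite rmorph_prod (bigD1 (C i)) //= big1 => [|j jC].
    by rewrite rmorphXn /= mevalXU tE eqxx rE mulr1.
  by rewrite rmorphXn /= mevalXU tE (negbTE jC) expr1n.
have tP : (tpoly KK g).@[t] = 0.
  by rewrite raddf_sum /= (eq_bigr _ (fun i _ => tmonX i)).
exists (Point tP); split=> [i|i j]; first by rewrite ev_tpi -tmonE /= tmonX.
rewrite /= tE; case: (j =P C i) => _; last by rewrite oner_eq0.
by rewrite -rE expf_eq0 texp_gt0.
Qed.

Definition only_zero (t : point) k := forall k', (t k' == 0) = (k' == k).

Lemma exists_only_zero k : exists t, only_zero t k.
Proof.
move: k; apply: tvarP => i j.
pose a : 'I_3 := if i == 0 then 1 else 0.
have ai : a != i by rewrite /a; case: (eqVneq i 0) => [->|]; rewrite // eq_sym.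
have [b [ba bi all3]] := third_index ai.
pose X (i' : 'I_3) : KK := if i' == i then 0 else if i' == a then 1 else -1.
(* One variable in each block, with [j] chosen in the block [i]. *)
pose C i' : 'I_(nvar g i') :=
  if i =P i' is ReflectT e then ecast i' ('I_(nvar g i')) e j
  else Ordinal (nvar_gt0 g i').
have Ci : C i = j by rewrite /C; case: eqP => // e; rewrite (eq_axiomK e).
have [|t [_ t0]] := @exists_point X C.
  rewrite (big_ord3 _ _ ai ba bi all3) /= /X eqxx (negbTE ai) eqxx.
  by rewrite (negbTE bi) (negbTE ba) add0r subrr.
exists t; apply: tvarP => i' j'; rewrite t0 /X.
have [e|ii'] := eqVneq i' i; last first.
  case: (i' == a); rewrite ?oppr_eq0 oner_eq0 andbF; apply/esym/eqP;
    by move=> /tvar_block e; rewrite e eqxx in ii'.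
subst i'; by rewrite eqxx andbT Ci (inj_eq (@tvar_inj g i)).
Qed.

Lemma ev_tX_eq0 t k m : only_zero t k -> (ev t (tX m) == 0) = (0 < m k)%N.
Proof.
move=> tk; rewrite ev_tX prodf_seq_eq0; apply/hasP/idP => [[k' _]|mk].
  by rewrite /= expf_eq0 tk => /andP[mk' /eqP <-].
by exists k; rewrite ?mem_index_enum //= expf_eq0 mk tk eqxx.
Qed.

(** On the points with [x_0 = 1] and [x_1 = s], the element takes the value [P(s)]
    up to a nonzero factor, where [P] is the dehomogenized binary form. *)
Lemma generic_nonvanishing (x : R) : homogeneous x -> x != 0 ->
  exists2 P : {poly KK}, P != 0 &
    forall t : point, (forall k, t k != 0) -> ev t (tx 0) = 1 ->
      P.[ev t (tx 1)] != 0 -> ev t x != 0.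
Proof.
move=> [w xw] x0; have [u [N uN]] := comp_binform KK w (isT : (0 : 'I_3) != 1).
have [P [sP xE]] := uN x xw; exists P.
  apply: contraNneq x0 => P0; rewrite xE P0 /binform big1 ?mulr0 // => j _.
  by rewrite coef0 scale0r.
move=> t t0 t1; rewrite (horner_coef_wide _ sP) => Pt.
rewrite xE rmorphM /= ev_binform mulf_neq0 //.
  by rewrite ev_tX prodf_seq_neq0; apply/allP => k _; rewrite expf_neq0.
by under eq_bigr => j _ do rewrite t1 expr1n mul1r.
Qed.

Lemma generic_point (P : {poly KK}) : P != 0 ->
  exists t : point, [/\ forall k, t k != 0, ev t (tx 0) = 1 &
    P.[ev t (tx 1)] != 0].
Proof.
(* The extra factors keep [x_1 = s] and [x_2 = - 1 - s] away from zero. *)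
move=> P0; have : 'X * ('X + 1) * P != 0.
  by rewrite !mulf_neq0 ?polyX_eq0 // -[1]opprK -polyCN polyXsubC_eq0.
move=> /closed_nonrootP[s].
rewrite /root !hornerM hornerD hornerX hornerC !mulf_eq0 !negb_or.
move=> /andP[/andP[s0 s1] Ps].
have [|t [tX tE]] := @exists_point (fun i => [:: 1; s; -1 - s]`_i)
                       (fun i => Ordinal (nvar_gt0 g i)).
  by rewrite !big_ord_recl big_ord0 /= addr0 -opprD addrA subrr.
exists t; rewrite !tX; split=> //.
apply: tvarP => i j; rewrite tE negb_and; apply/orP; right.
case: i j => [[|[|[|//]]]] ? _ /=; rewrite ?oner_eq0 //.
by rewrite -opprD oppr_eq0 addrC.
Qed.

(** Both factors are nonzero at a common generic point, so their product is too. *)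
Lemma homog_mul_neq0 (x y : R) : homogeneous x -> homogeneous y ->
  x != 0 -> y != 0 -> x * y != 0.
Proof.
move=> hx hy x0 y0; have [P P0 Px] := generic_nonvanishing hx x0.
have [Q Q0 Qy] := generic_nonvanishing hy y0.
have PQ0 : P * Q != 0 by rewrite mulf_neq0.
have [t [t0 t1]] := generic_point PQ0.
rewrite hornerM mulf_eq0 negb_or => /andP[Pt Qt].
have : ev t x * ev t y != 0 by rewrite mulf_neq0 ?Px ?Qy.
by apply: contraNneq => xy0; rewrite -rmorphM xy0 rmorph0.
Qed.

Lemma homog_cancel (a y z : R) : homogeneous a -> a != 0 -> a * y = a * z -> y = z.
Proof.
move=> [w aw] a0 /eqP; rewrite -subr_eq0 -mulrBr => /eqP ayz.
apply/eqP; rewrite -subr_eq0; apply/eqP/rcomp_eq0 => w'; apply/eqP.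
apply: contraTT (eqxx (0 : R)) => yz0.
have : a * rcomp w' (y - z) != 0.
  by apply: homog_mul_neq0 => //; [exists w|exists w'; apply: in_comp_rcomp].
have := rcompM (w' + w) (y - z) aw; rewrite addrK => <-.
by rewrite ayz (rcomp_in_comp _ (in_comp0 KK w)) if_same eqxx.
Qed.

Lemma tX_neq0 m : tX m != 0.
Proof.
have [t [t0 _ _]] := generic_point (oner_neq0 {poly KK}).
suff : ev t (tX m) != 0 by apply: contraNneq => ->; rewrite rmorph0.
by rewrite ev_tX prodf_seq_neq0; apply/allP => k _; rewrite expf_neq0.
Qed.

(** Write the elements of the component as [T^u F(x_a, x_i)].  If [T_ij] occurs in
    [u] it divides all of them.  Otherwise [T^u] does not vanish at [t], where
    [x_i = 0], so an element vanishing there has a form [F] without pure power of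
    [x_a]. *)
Lemma comp_vanishing i (j : 'I_(nvar g i)) t w : only_zero t (tvar j) ->
  (forall x : R, in_comp w x -> exists y, x = tX U_(tvar j) * y) \/
  (forall x : R, in_comp w x -> ev t x = 0 -> exists y, x = tx i * y).
Proof.
move=> tj; have [a ai] : exists a, a != i.
  by exists (if i == 0 then 1 else 0); case: (eqVneq i 0) => [->|] //; rewrite eq_sym.
have [u [N uN]] := comp_binform KK w ai.
have [uj|uj] := posnP (u (tvar j)); [right|left] => x /uN[P [sP ->]]; last first.
  exists (tX (u - U_(tvar j)) * binform N P (tx a) (tx i)).
  rewrite mulrA -tXD addmC submK //; apply/mnm_lepP => k; rewrite mnm1E.
  by case: eqP => // <-.
have evi : ev t (tx i) = 0.
  by apply/eqP; rewrite (ev_tX_eq0 _ tj) xmnm_tvar eqxx texp_gt0.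
have eva : ev t (tx a) != 0.
  by rewrite (ev_tX_eq0 _ tj) xmnm_tvar eq_sym (negbTE ai).
rewrite rmorphM => /eqP; rewrite mulf_eq0 (ev_tX_eq0 _ tj) uj /= ev_binform.
rewrite big_ord_recl big1 => [|k _]; last by rewrite evi exprS mul0r !mulr0.
rewrite evi subn0 expr0 mulr1 addr0 mulf_eq0 expf_eq0 (negbTE eva) andbF orbF /= => P0.
case: N sP {uN} => [|N] sP.
  by exists 0; rewrite /binform big_ord1 /= (eqP P0) scale0r !mulr0.
have /factor_theorem[Q PE] : root P 0 by rewrite /root horner_coef0.
exists (tX u * binform N Q (tx a) (tx i)).
by rewrite PE polyC0 subr0 [Q * _]mulrC binformMr mulrCA.
Qed.

(** A variable is prime among homogeneous elements: divisibility by it is the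
    vanishing at a point. *)
Lemma var_divides t k (x : R) : only_zero t k -> homogeneous x -> ev t x = 0 ->
  exists2 y, homogeneous y & x = tX U_(k) * y.
Proof.
move: k; apply: tvarP => i j tj hx xt.
have [y xE] : exists y, x = tX U_(tvar j) * y.
  have [w xw] := hx; case: (comp_vanishing w tj) => [/(_ x xw)//|/(_ x xw xt)[y xE]].
  exists (tX (xmnm g i - U_(tvar j)) * y); rewrite mulrA -tXD addmC submK -?xE //.
  apply/mnm_lepP => k; rewrite mnm1E; case: eqP => // <-.
  by rewrite xmnm_tvar eqxx texp_gt0.
have [z hz zE] := homog_quot (homogX KK U_(tvar j)) (eq_ind _ _ hx _ xE).
by exists z; rewrite // -zE.
Qed.

End Points.

(** * Division by monomials and the chain rule *)

Section Derivation.
Variables (KK : closedFieldType) (g : trinomial).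
Local Notation R := (talg KK g).
Local Notation tX m := (tpi ('X_[m] : {mpoly KK[tnum g]}) : R).
Local Notation tx i := (tX (xmnm g i)).
Local Notation T j := (tX U_(tvar j)).

(** One variable of [T^m] is split off at a time; it is prime and does not divide
    [T^m']. *)
Lemma disjoint_monomial_divides (m m' : 'X_{1..tnum g}) (f z : R) : homogeneous f ->
  (forall k, 0 < m k -> m' k = 0)%N -> tX m' * f = tX m * z ->
  exists2 h, homogeneous h & f = tX m * h.
Proof.
elim: {m}(mdeg m) {-2}m (erefl (mdeg m)) f z => [|n IH] m mn f z hf disj E.
  exists f => //; move/eqP: mn; rewrite mdeg_eq0 => /eqP ->.
  by rewrite mpolyX0 rmorph1 mul1r.
have [k mk] : exists k, (0 < m k)%N.
  apply: contrapT => no; have : m = 0%MM.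
    apply/mnmP => k; rewrite mnm0E; apply/eqP; rewrite -leqn0 leqNgt.
    by apply/negP => mk; apply: no; exists k.
  by move=> m0; rewrite m0 mdeg0 in mn.
have mE : m = (U_(k) + (m - U_(k)))%MM.
  by rewrite addmC submK //; apply/mnm_lepP => l; rewrite mnm1E; case: eqP => // <-.
have [t tk] := exists_only_zero KK k.
have [|f1 hf1 fE] := var_divides tk hf.
  have : ev t (tX m' * f) == 0 by rewrite E rmorphM /= mulf_eq0 (ev_tX_eq0 _ tk) mk.
  by rewrite rmorphM /= mulf_eq0 (ev_tX_eq0 _ tk) disj //= => /eqP.
have mn' : mdeg (m - U_(k))%MM = n.
  by move: mn; rewrite {1}mE mdegD mdeg1 add1n => -[].
have disj' l : (0 < (m - U_(k))%MM l -> m' l = 0)%N.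
  by rewrite mnmBE => lt; apply: disj; apply: leq_trans lt (leq_subr _ _).
have [|h hh f1E] := IH _ mn' f1 z hf1 disj'.
  apply: (homog_cancel (homogX KK U_(k)) (tX_neq0 KK _)).
  by rewrite mulrCA -fE E {1}mE tXD mulrA.
by exists h; rewrite // fE f1E mulrA -tXD -mE.
Qed.

Section ChainRule.
Variable D : {linear R -> R}.
Hypothesis D_leibniz : leibniz D.

Lemma leibniz_chain p :
  D (tpi p) = \sum_k tpi (p^`M(k)) * D (tX U_(k)).
Proof.
have D1 : D 1 = 0.
  have := D_leibniz 1 1; rewrite !mulr1 mul1r => /eqP.
  by rewrite -[X in X == _]addr0 (inj_eq (addrI _)) eq_sym => /eqP.
pose S p := D (tpi p) = \sum_k tpi (p^`M(k)) * D (tX U_(k)).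
have SD q r : S q -> S r -> S (q + r).
  rewrite /S rmorphD linearD => -> ->; rewrite -big_split; apply: eq_bigr => k _.
  by rewrite mderivD rmorphD mulrDl.
have SM q r : S q -> S r -> S (q * r).
  rewrite /S rmorphM D_leibniz => -> ->.
  rewrite mulr_suml mulr_sumr -big_split; apply: eq_bigr => k _.
  by rewrite mderivM rmorphD !rmorphM mulrDl mulrAC mulrA.
have SZ c q : S q -> S (c *: q).
  rewrite /S !linearZ /= => ->; rewrite scaler_sumr; apply: eq_bigr => k _.
  by rewrite mderivZ linearZ scalerAl.
have S1 : S 1.
  rewrite /S rmorph1 D1 big1 // => k _.
  by rewrite -mpolyC1 mderivC rmorph0 mul0r.
have SX k : S 'X_k.
  rewrite /S (bigD1 k) //= mderivXU eqxx rmorph1 mul1r big1 ?addr0 // => l lk.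
  by rewrite mderivXU eq_sym (negbTE lk) rmorph0 mul0r.
rewrite -/(S p); elim/mpolyind: p => [|c m p _ _ Sp].
  by rewrite -(scale0r 1); apply: SZ.
apply: SD => //; apply: SZ; rewrite mpolyXE_id.
apply: (big_ind S) => // k _; elim: (m k) => [|n IH]; first by rewrite expr0.
by rewrite exprS; apply: SM.
Qed.

Lemma sum_tvar (V : nmodType) (F : 'I_(tnum g) -> V) (C : forall i, 'I_(nvar g i)) :
  (forall i (j : 'I_(nvar g i)), j != C i -> F (tvar j) = 0) ->
  \sum_k F k = \sum_i F (tvar (C i)).
Proof.
move=> F0; rewrite (reindex (@enum_rank (tidx g))) /=; last first.
  by exists enum_val => k _; rewrite ?enum_rankK ?enum_valK.
have -> : \sum_(v : tidx g) F (enum_rank v) = \sum_i \sum_(j < nvar g i) F (tvar j).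
  by rewrite sig_big_dep /=; apply: eq_bigr => -[i j] _.
by apply: eq_bigr => i _; rewrite (bigD1 (C i)) //= big1 ?addr0 // => j /F0.
Qed.

Variable C : forall i, 'I_(nvar g i).
Hypothesis DC : forall i (j : 'I_(nvar g i)), j != C i -> D (T j) = 0.

Lemma derivation_tpi p : D (tpi p) = \sum_i tpi (p^`M(tvar (C i))) * D (T (C i)).
Proof.
rewrite leibniz_chain (@sum_tvar _ _ C) // => i j jC.
by rewrite DC // mulr0.
Qed.

Lemma derivation_tx i :
  D (tx i) = tpi ((tmon KK g i)^`M(tvar (C i))) * D (T (C i)).
Proof.
rewrite -tmonE derivation_tpi (bigD1 i) //= big1 ?addr0 // => k ki.
by rewrite mderiv_tmon_neq 1?eq_sym // rmorph0 mul0r.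
Qed.

Lemma mderiv_tmon i (j : 'I_(nvar g i)) :
  tpi ((tmon KK g i)^`M(tvar j))
  = (texp j)%:R *: tX (xmnm g i - U_(tvar j)).
Proof. by rewrite tmonE mderivX linearZ xmnm_tvar eqxx. Qed.

End ChainRule.
End Derivation.

(** * Homogeneous locally nilpotent derivations of the trinomial algebra *)

Section HomogeneousLND.
Variables (KK : closedFieldType) (g : trinomial).
Hypothesis charKK : [pchar KK] =i pred0.
Local Notation R := (talg KK g).
Local Notation tX m := (tpi ('X_[m] : {mpoly KK[tnum g]}) : R).
Local Notation tx i := (tX (xmnm g i)).
Local Notation T j := (tX U_(tvar j)).
Variable d : {linear R -> R}.
Hypothesis d_leibniz : leibniz d.
Hypothesis d_lnd : locally_nilpotent d.
Hypothesis d_homog : homogeneous_map d.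

Let mulH := @homog_mul_neq0 KK g.

Lemma neq0_of_image (x : R) : d x != 0 -> x != 0.
Proof. by apply: contraNneq => ->; rewrite linear0. Qed.

(** A homogeneous map need not shift all degrees by the same amount a priori, but a
    derivation does: the two terms of [d (x * y)] are nonzero and their sum is
    homogeneous, so they have the same degree. *)
Lemma same_degree_shift (wx wy : degGroup g) (x y : R) :
  in_comp wx x -> in_comp wy y -> d x != 0 -> d y != 0 ->
  exists w, in_comp (w + wx) (d x) /\ in_comp (w + wy) (d y).
Proof.
move=> hx hy dx0 dy0; have x0 := neq0_of_image dx0; have y0 := neq0_of_image dy0.
have [a ha] : homogeneous (d x) by apply: d_homog; exists wx.
have [b hb] : homogeneous (d y) by apply: d_homog; exists wy.
have E : a + wy = wx + b.
  apply: (homog_add_same_degree (in_compM ha hy) (in_compM hx hb)).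
  - exact: (mulH (ex_intro _ a ha) (ex_intro _ wy hy) dx0 y0).
  - exact: (mulH (ex_intro _ wx hx) (ex_intro _ b hb) x0 dy0).
  - by rewrite -d_leibniz; apply: d_homog; exists (wx + wy); apply: in_compM.
exists (a - wx); rewrite subrK; split=> //.
by rewrite (_ : a - wx + wy = b) // addrAC E addrC addrA addNr add0r.
Qed.

Lemma image_not_vanishing t k : only_zero t k -> d (tX U_(k)) != 0 ->
  ev t (d (tX U_(k))) != 0.
Proof.
move=> tk; apply: contraNN => /eqP /(var_divides tk (d_homog (homogX KK U_(k)))).
move=> [y hy dE]; apply/eqP.
exact: (not_self_dividing_derivative charKK d_leibniz d_lnd d_homog mulH
          (homogX KK U_(k)) hy dE).
Qed.

Lemma ev_T t k k' : only_zero t k -> (ev t (tX U_(k')) == 0) = (k' == k).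
Proof. by move=> tk; rewrite (ev_tX_eq0 _ tk) mnm1E; case: (k' == k). Qed.

(** [T_j d(T_j')] and [T_j' d(T_j)] have the same degree.  At a point where only
    [T_j] is zero the first vanishes and the second does not, so the first is
    divisible by [x_i], hence by [T_j'], which would then divide its own
    derivative. *)
Lemma moved_variable_uniq i (j j' : 'I_(nvar g i)) :
  d (T j) != 0 -> d (T j') != 0 -> j = j'.
Proof.
move=> dj dj'; apply/eqP; apply: contraT => jj'.
have neq : tvar j != tvar j' by rewrite (inj_eq (@tvar_inj g i)).
have hT (l : 'I_(nvar g i)) := @in_compX KK g U_(tvar l).
have hj := hT j; have hj' := hT j'.
set wj := mnm_degK _ in hj; set wj' := mnm_degK _ in hj'.
have [w [hd hd']] := same_degree_shift hj hj' dj dj'.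
have [t tj] := exists_only_zero KK (tvar j).
have [t' tj'] := exists_only_zero KK (tvar j').
have h1 := in_compM hj' hd; have h2 := in_compM hj hd'.
have vE : wj + (w + wj') = wj' + (w + wj).
  by rewrite addrCA [in RHS]addrCA [wj + _]addrC.
rewrite vE in h2.
have [/(_ _ h1)[y E]|/(_ _ h2)[|y E]] :=
  comp_vanishing (wj' + (w + wj)) tj.
  have /eqP := congr1 (ev t) E; rewrite !rmorphM /=.
  have /eqP -> : ev t (T j) == 0 by rewrite (ev_T _ tj).
  rewrite mul0r mulf_eq0 (ev_T _ tj) eq_sym (negbTE neq) /=.
  by rewrite (negbTE (image_not_vanishing tj dj)).
- have /eqP Tj0 : ev t (T j) == 0 by rewrite (ev_T _ tj).
  by rewrite rmorphM /= Tj0 mul0r.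
have /eqP := congr1 (ev t') E; rewrite !rmorphM /=.
have /eqP -> : ev t' (tx i) == 0.
  by rewrite (ev_tX_eq0 _ tj') xmnm_tvar eqxx texp_gt0.
rewrite mul0r mulf_eq0 (ev_T _ tj') (negbTE neq) /=.
by rewrite (negbTE (image_not_vanishing tj' dj')).
Qed.

Lemma exists_moved_variables :
  exists C : forall i, 'I_(nvar g i),
    forall i (j : 'I_(nvar g i)), j != C i -> d (T j) = 0.
Proof.
apply: (@fin_all_exists _ _ (fun i c =>
  forall j : 'I_(nvar g i), j != c -> d (T j) = 0)) => i.
have [[c dc]|no] := EM (exists c : 'I_(nvar g i), d (T c) != 0).
  exists c => j jc; apply/eqP; apply: contraNT jc => dj.
  by apply/eqP; apply: moved_variable_uniq.
exists (Ordinal (nvar_gt0 g i)) => j _; apply/eqP; apply: contraT => dj.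
by case: no; exists j.
Qed.

Section MovedVariables.
Variable C : forall i, 'I_(nvar g i).
Hypothesis dC : forall i (j : 'I_(nvar g i)), j != C i -> d (T j) = 0.

Local Notation expC i := (texp (C i)).
(* The exponent of [x_i] divided by its moved variable. *)
Local Notation M i := (xmnm g i - U_(tvar (C i)))%MM.

Lemma M_tvar i i' (j : 'I_(nvar g i')) : M i (tvar j) =
  if i' == i then (texp j - (tvar (C i) == tvar j))%N else 0%N.
Proof.
rewrite mnmBE xmnm_tvar mnm1E; case: eqP => // ii'.
Qed.

Lemma d_tx i : d (tx i) = (expC i)%:R *: (tX (M i) * d (T (C i))).
Proof. by rewrite (derivation_tx d_leibniz dC) mderiv_tmon scalerAl. Qed.

Lemma expC_neq0 i : (expC i)%:R != 0 :> KK.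
Proof. by rewrite ((pcharf0P KK).1 charKK) -lt0n texp_gt0. Qed.

Lemma tX_M i : T (C i) * tX (M i) = tx i.
Proof.
rewrite -tXD addmC submK //; apply/mnm_lepP => k; rewrite mnm1E.
by case: eqP => // <-; rewrite xmnm_tvar eqxx texp_gt0.
Qed.

Lemma d_tx_eq0 i : (d (tx i) == 0) = (d (T (C i)) == 0).
Proof.
rewrite d_tx scaler_eq0 (negbTE (expC_neq0 i)) /=.
apply/eqP/eqP => [/eqP|->]; last by rewrite mulr0.
apply: contraTeq => dT0.
exact: (mulH (homogX KK (M i)) (d_homog (homogX KK _)) (tX_neq0 KK _) dT0).
Qed.

(** Compare [d(x_i)] and [d(x_i')], which have the same degree, at a point where
    only the moved variable of the block [i] is zero.  Since its exponent in [x_i]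
    exceeds 1, [d(x_i)] vanishes there.  If it were divisible by [x_i], the moved
    variable would divide its own derivative; hence [d(x_i')] is divisible by the
    moved variable. *)
Lemma divides_other_image i i' : i != i' -> d (T (C i)) != 0 ->
  d (T (C i')) != 0 -> (1 < expC i)%N ->
  exists2 y, homogeneous y & d (T (C i')) = T (C i) * y.
Proof.
move=> ii' di di' e1; have [t ti] := exists_only_zero KK (tvar (C i)).
apply: (var_divides ti); first by apply/d_homog/homogX.
have hx k := @in_compX KK g (xmnm g k).
have [||w [hd hd']] := same_degree_shift (hx i) (hx i'); rewrite ?d_tx_eq0 //.
rewrite (mnm_degK_xmnm g i' i) in hd'.
have [/(_ _ hd')[y E]|/(_ _ hd)[|y E]] :=
  comp_vanishing (w + mnm_degK (xmnm g i)) ti.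
- have /eqP := congr1 (ev t) E; rewrite d_tx evZ !rmorphM /=.
  have /eqP -> : ev t (T (C i)) == 0 by rewrite (ev_T _ ti).
  rewrite mul0r !mulf_eq0 (negbTE (expC_neq0 i')) (ev_tX_eq0 _ ti) M_tvar.
  by rewrite (negbTE ii') /= => /eqP.
- rewrite d_tx evZ rmorphM /=.
  have /eqP -> : ev t (tX (M i)) == 0.
    by rewrite (ev_tX_eq0 _ ti) M_tvar !eqxx /= subn_gt0.
  by rewrite mul0r mulr0.
have dTE : d (T (C i)) = T (C i) * ((expC i)%:R^-1 *: y).
  apply: (homog_cancel (homogX KK (M i)) (tX_neq0 KK _)).
  apply: (scalerI (expC_neq0 i)); rewrite -d_tx E -tX_M.
  by rewrite -!scalerAr scalerA mulfV ?expC_neq0 // scale1r mulrCA mulrA.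
have := image_not_vanishing ti di; rewrite dTE rmorphM /=.
by rewrite mulf_eq0 (ev_T _ ti) eqxx.
Qed.

Lemma not_both_exponents_gt1 i i' : i != i' -> d (T (C i)) != 0 -> d (T (C i')) != 0 ->
  (1 < expC i)%N -> (1 < expC i')%N -> False.
Proof.
move=> ii' di di' ei ei'.
have [y hy dE'] := divides_other_image ii' di di' ei.
have [|y' hy' dE] := divides_other_image _ di' di ei'; first by rewrite eq_sym.
have := mutually_dividing_derivatives charKK d_leibniz d_lnd d_homog mulH
  (homogX KK _) (homogX KK _) hy hy' dE' dE.
by case=> /eqP e; rewrite e in di di'.
Qed.

Lemma two_moved_blocks : (exists x, d x <> 0) ->
  exists a b, [/\ a != b, d (T (C a)) != 0 & d (T (C b)) != 0].
Proof.
move=> [x dx]; have [a da] : exists a, d (T (C a)) != 0.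
  apply: contrapT => no; apply: dx; have [p ->] := tpi_surj x.
  rewrite (derivation_tpi d_leibniz dC) big1 // => i _.
  have [->|di] := eqVneq (d (T (C i))) 0; first by rewrite mulr0.
  by case: no; exists i.
exists a; apply: contrapT => no; have : d (tx a) = 0; last first.
  by move/eqP; rewrite d_tx_eq0 (negbTE da).
have := congr1 d (tpi_tpoly_sum KK g); rewrite linear0 linear_sum (bigD1 a) //= => <-.
rewrite big1 ?addr0 // => b ba; apply/eqP; rewrite d_tx_eq0.
by apply: contraT => db; case: no; exists b; rewrite eq_sym ba.
Qed.

(** The relation [d(x_a) + d(x_b) = 0] reads
    [l_a T^(M a) d(T_a) = - l_b T^(M b) d(T_b)] with coprime monomials, where
    [T_a], [T_b] are the moved variables, so [T^(M b)] divides [d(T_a)]; the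
    second equation follows by cancellation. *)
Lemma moved_factorization a b c : a != b -> c != a -> c != b ->
    (forall i, [\/ i = a, i = b | i = c]) ->
    d (T (C a)) != 0 -> d (T (C c)) = 0 ->
  exists2 h, homogeneous h & d (T (C a)) = h * ((expC b)%:R *: tX (M b)) /\
    d (T (C b)) = h * (- (expC a)%:R *: tX (M a)).
Proof.
move=> ab ca cb all3 da dc.
have S : (expC a)%:R *: (tX (M a) * d (T (C a)))
       = - (expC b)%:R *: (tX (M b) * d (T (C b))).
  have := congr1 d (tpi_tpoly_sum KK g).
  rewrite linear0 linear_sum (big_ord3 _ _ ab ca cb all3) /= !d_tx dc.
  by rewrite mulr0 scaler0 addr0 => /eqP; rewrite addr_eq0 scaleNr => /eqP.
have [|||h hh dE] := @disjoint_monomial_divides KK g (M b) (M a) (d (T (C a)))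
    ((expC a)%:R^-1 *: (- (expC b)%:R *: d (T (C b)))).
- by apply/d_homog/homogX.
- apply: tvarP => i j; rewrite !M_tvar; case: (i =P b) => // ib.
  by case: (i =P a) => // ia; rewrite -ia ib eqxx in ab.
- apply: (scalerI (expC_neq0 a)).
  by rewrite S -!scalerAr !scalerA mulrA mulfV ?expC_neq0 // mul1r.
exists ((expC b)%:R^-1 *: h); first exact: homogZ.
rewrite -!scalerAl -!scalerAr !scalerA mulVf ?expC_neq0 // scale1r.
split; first by rewrite dE mulrC.
apply: (homog_cancel (homogX KK (M b)) (tX_neq0 KK _)).
apply: (scalerI (expC_neq0 b)); apply: oppr_inj; rewrite -scaleNr -S dE.
rewrite -!scalerAr scalerA mulVKf ?expC_neq0 // scaleNr opprK.
by rewrite mulrCA [h * _]mulrC mulrA.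
Qed.

End MovedVariables.

(** Take [s] with [d s] a nonzero element of the kernel: [h] is a factor of it. *)
Lemma cofactor_in_ker (h : R) (d' : R -> R) : homogeneous h ->
  (exists2 x, homogeneous x & d x != 0) ->
  (forall x, d x = h * d' x) -> d h = 0.
Proof.
move=> hh [x hx dx0] dE.
have [s [hs ds dds]] := local_slice d_lnd d_homog hx dx0.
have h0 : h != 0 by apply: contraNneq dx0 => h0; rewrite dE h0 mul0r.
have [|z hz sE] := homog_quot (y := d' s) hh; first by rewrite -dE; apply: d_homog.
rewrite -dE in sE.
apply: (ker_factorially_closed charKK d_leibniz d_lnd d_homog mulH hh hz) => //.
  by apply: contraNneq ds => z0; rewrite sE z0 mulr0.
by rewrite -sE.
Qed.

End HomogeneousLND.

Theorem theorem1 (KK : closedFieldType) (charKK : [pchar KK] =i pred0)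
    (g : trinomial)
    (exp1 : forall (i1 i2 : 'I_3) (j1 : 'I_(nvar g i1)) (j2 : 'I_(nvar g i2)),
      texp j1 = 1%N -> texp j2 = 1%N -> i1 = i2)
    (d : {linear talg KK g -> talg KK g})
    (d_leibniz : leibniz d)
    (d_lnd : locally_nilpotent d)
    (d_homog : homogeneous_map d)
    (d_neq0 : exists x, d x <> 0) :
  elementaryII d.
Proof.
have [C dC] := exists_moved_variables charKK d_leibniz d_lnd d_homog.
have [a [b [ab da db]]] := two_moved_blocks charKK d_leibniz d_homog dC d_neq0.
have [c [ca cb all3]] := third_index ab.
have not_both := not_both_exponents_gt1 charKK d_leibniz d_lnd d_homog dC.
have exponent1_of_moved i i' : i != i' -> d (tpi 'X_(tvar (C i))) != 0 ->
    d (tpi 'X_(tvar (C i'))) != 0 -> texp (C i) = 1%N \/ texp (C i') = 1%N.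
  move=> ii' di di'; have [e|n] := eqVneq (texp (C i)) 1%N; first by left; exact: e.
  have [e|n'] := eqVneq (texp (C i')) 1%N; first by right; exact: e.
  have gt1 k : texp (C k) != 1%N -> (1 < texp (C k))%N.
    by move=> ne; rewrite ltn_neqAle eq_sym ne texp_gt0.
  by case: (not_both _ _ ii' di di' (gt1 _ n) (gt1 _ n')).
have dc : d (tpi 'X_(tvar (C c))) = 0.
  apply/eqP; apply: contraT => dc.
  case: (exponent1_of_moved _ _ ab da db) => e1;
    [have := exponent1_of_moved _ _ cb dc db | have := exponent1_of_moved _ _ ca dc da].
    case=> e2; first by move: ca; rewrite (exp1 _ _ _ _ e1 e2) eqxx.
    by move: ab; rewrite (exp1 _ _ _ _ e1 e2) eqxx.
  case=> e2; first by move: cb; rewrite (exp1 _ _ _ _ e1 e2) eqxx.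
  by move: ab; rewrite (exp1 _ _ _ _ e1 e2) eqxx.
have [h hh [dEa dEb]] :=
  moved_factorization charKK d_leibniz d_homog dC ab ca cb all3 da dc.
(* The two moved blocks cancel each other, the third one has weight zero. *)
pose beta i : KK := if i == a then 1 else if i == b then -1 else 0.
have beta_a : beta a = 1 by rewrite /beta eqxx.
have beta_b : beta b = -1 by rewrite /beta eq_sym (negbTE ab) eqxx.
have beta_c : beta c = 0 by rewrite /beta (negbTE ca) (negbTE cb).
have beta_sum : \sum_i beta i = 0.
  by rewrite (big_ord3 _ _ ab ca cb all3) /= beta_a beta_b beta_c addr0 subrr.
have dT i : d (tpi 'X_(tvar (C i))) = h * tpi (delta_val C beta i).
  have only_b k : (k != a) && (beta k != 0) = (k == b).
    case: (all3 k) => ->; first by rewrite eqxx (negbTE ab).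
      by rewrite beta_b oppr_eq0 oner_eq0 eq_sym ab eqxx.
    by rewrite beta_c eqxx andbF (negbTE cb).
  have only_a k : (k != b) && (beta k != 0) = (k == a).
    case: (all3 k) => ->; first by rewrite beta_a oner_eq0 ab eqxx.
      by rewrite eqxx [b == a]eq_sym (negbTE ab).
    by rewrite beta_c eqxx andbF (negbTE ca).
  case: (all3 i) => ->; rewrite /delta_val.
  - by rewrite (big_pred1 b only_b) beta_a scale1r mderiv_tmon.
  - rewrite (big_pred1 a only_a) beta_b linearZ /= mderiv_tmon scalerA mulN1r.
    exact: dEb.
  by rewrite beta_c scale0r rmorph0 mulr0.
have dE x : d x = h * delta C beta x.
  have [p ->] := tpi_surj x; rewrite (derivation_tpi d_leibniz dC) delta_tpi //.
  rewrite /delta_poly rmorph_sum mulr_sumr; apply: eq_bigr => i _.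
  by rewrite dT rmorphM mulrC mulrA.
exists C, beta, h; split=> //.
- split=> //; exists c; split=> // [i ic|i1 i2 i1c i2c e1 e2].
    by case: (all3 i) ic => -> ; rewrite ?beta_a ?beta_b ?oppr_eq0 ?oner_eq0 // eqxx.
  have dneq i : i != c -> d (tpi 'X_(tvar (C i))) != 0.
    move=> /eqP ic; case: (all3 i) => [->|->|/ic[]]; [exact: da|exact: db].
  apply/eqP; apply: contraT => i12.
  by case: (not_both _ _ i12 (dneq _ i1c) (dneq _ i2c) e1 e2).
have h0 : h != 0 by apply: contraNneq da => h0; rewrite dE h0 mul0r.
apply: (homog_cancel hh h0); rewrite mulr0 -dE.
apply: (cofactor_in_ker charKK d_leibniz d_lnd d_homog hh _ dE).
exact: (ex_intro2 _ _ (tpi 'X_(tvar (C a))) (homogX KK _) da).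
Qed.
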